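(* Assume problem $(\mathcal P)$ (defined in the context) is feasible. Then there exists a solution (optimal point) $x^\star$ of the convexified problem $(\hat{\mathcal P})$ such that $$\hat p = \hat f(x^\star) \le f(x^\star) \le \hat p + \sum_{i=1}^{\min(\tilde m,n)} \rho(f_i).$$
   Context: Setting. Let $N=\sum_{i=1}^n n_i$ and write $x=(x_1,\dots,x_n)\in\mathbf{R}^N$ with blocks $x_i\in\mathbf{R}^{n_i}$. For each $i$, $S_i\subset\mathbf{R}^{n_i}$ is a compact set and $f_i:S_i\to\mathbf{R}$ is lower semi-continuous (no convexity of $f_i$ or $S_i$ is assumed). Let $A\in\mathbf{R}^{m_1\times N}$, $b\in\mathbf{R}^{m_1}$, $G\in\mathbf{R}^{m_2\times N}$, $h\in\mathbf{R}^{m_2}$. The problem $(\mathcal P)$ is: minimize $f(x)=\sum_{i=1}^n f_i(x_i)$ subject to $Ax\le b$, $Gx=h$ (with $x_i\in S_i$ for all $i$); its optimal value is $p^\star$. A point $x$ is feasible for $(\mathcal P)$ if $Ax\le b$, $Gx=h$ and $x_i\in S_i$ for all $i$; $(\mathcal P)$ is feasible if it has a feasible point. It is assumed that each of the linear equality and inequality constraints involves at least two blocks of variables. Conventions. Functions are taken to be $+\infty$ outside their domains, so $f(x)=+\infty$ if some $x_i\notin S_i$, and $\infty-\infty$ is interpreted as $0$. Inequalities are in the extended reals. Convex envelope. $\hat f_i:\mathrm{conv}(S_i)\to\mathbf{R}$ denotes the convex envelope of $f_i$, the largest closed convex function majorized by $f_i$ (i.e. $\hat f_i(x)\le f_i(x)$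 for all $x$). Convexified problem $(\hat{\mathcal P})$: minimize $\hat f(x)=\sum_{i=1}^n\hat f_i(x_i)$ subject to $Ax\le b$, $Gx=h$ (with $x_i\in\mathrm{conv}(S_i)$ for all $i$); its optimal value is $\hat p$. Nonconvexity. $\rho(f_i)=\sup_x\,(f_i(x)-\hat f_i(x))\in[0,\infty]$, with the supremum taken with $f_i$ and $\hat f_i$ equal to $+\infty$ outside their respective domains $S_i$ and $\mathrm{conv}(S_i)$ and with $\infty-\infty$ interpreted as $0$ (so it may be $+\infty$). The functions are indexed so that $\rho(f_1)\ge\cdots\ge\rho(f_n)$. Number of active constraints. For $x\in\mathbf{R}^N$ let $J(x)=\{j:(Ax-b)_j=0\}$ be the active set of inequality constraints, $\tilde m_1=\max_{x}|J(x)|$ the maximal number of inequality constraints that can be simultaneously active (maximum over $x\in\mathbf{R}^N$), and $\tilde m=\tilde m_1+m_2$. *)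

(* Defs.v *)
From mathcomp Require Import all_boot all_order all_algebra.
From mathcomp Require Import all_classical all_reals all_analysis.

Set Implicit Arguments.
Unset Strict Implicit.
Unset Printing Implicit Defensive.

Import Order.TTheory GRing.Theory Num.Theory.
Import numFieldNormedType.Exports.

Local Open Scope classical_set_scope.
Local Open Scope ring_scope.
Local Open Scope ereal_scope.

Definition conv_hull (R : realType) (E : lmodType R) (S : set E) : set E :=
  smallest (@convex_set R E) S.

Definition extend (R : realType) (E : Type) (D : set E) (g : E -> \bar R) :
    E -> \bar R :=
  patch (cst +oo) D g.

Section envelope.
Context (R : realType) (E : normedModType R).
Implicit Types (f g : E -> \bar R) (S : set E).

Definition epigraph g : set (E * R^o) := [set p | g p.1 <= (p.2 : R)%:E].

Definition closed_convex g :=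
  [/\ forall x, g x != -oo, convex_set (epigraph g) & closed (epigraph g)].

Definition majorized g f := forall x, g x <= f x.

(* The largest closed convex function majorized by f, obtained as the
   pointwise supremum of all of them; see convex_envelopeP. *)
Definition convex_envelope f : E -> \bar R := fun x =>
  ereal_sup [set g x | g in [set g | closed_convex g /\ majorized g f]].

Lemma convex_envelopeP f :
    (exists g, closed_convex g /\ majorized g f) ->
  [/\ closed_convex (convex_envelope f), majorized (convex_envelope f) f &
      forall g, closed_convex g -> majorized g f ->
        majorized g (convex_envelope f)].
Proof.
move=> [g0 [[g0Ny g0c g0cl] g0f]].
have le_env g : closed_convex g -> majorized g f ->
    majorized g (convex_envelope f).
  by move=> gc gf x; apply: ereal_sup_ubound; exists g.
have epiE : epigraph (convex_envelope f) =
    \bigcap_(g in [set g | closed_convex g /\ majorized g f]) epigraph g.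
  apply/seteqP; split => [p /= pe g [gc gf]|p /= pe] /=.
    exact: le_trans (le_env _ gc gf _) pe.
  by apply: ge_ereal_sup => _ [g gcf <-]; exact: pe.
split => //.
- split.
  + move=> x; rewrite -ltNye; apply: lt_le_trans (le_env g0 _ g0f x) => //.
    by rewrite ltNye.
  + rewrite epiE => p q t /set_mem pe /set_mem qe; apply/mem_set => g gcf.
    have [[_ gc _] _] := gcf.
    by apply/set_mem/gc; apply/mem_set; [exact: pe|exact: qe].
  + by rewrite epiE; apply: closed_bigI => g [[]].
- by move=> x; apply: ge_ereal_sup => _ [g [_ gf] <-]; exact: gf.
Qed.

Definition fhat S (f : E -> R) : E -> \bar R :=
  extend (conv_hull S) (convex_envelope (extend S (EFin \o f))).

(* Subtraction with +oo - +oo = 0; the library's value is -oo. *)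
Definition sube_pinfty0 (a b : \bar R) : \bar R :=
  if (a == +oo) && (b == +oo) then 0 else a - b.

Definition nonconvexity S (f : E -> R) : \bar R :=
  ereal_sup (range (fun x => sube_pinfty0 (extend S (EFin \o f) x) (fhat S f x))).

End envelope.

Section separable_problem.
Context (R : realType) (n : nat) (k : 'I_n -> nat) (m1 m2 : nat).

(* A point of R^N is a column x whose i-th block is submxcol x i. *)
Local Notation N := (\sum_(i < n) k i)%N.

Implicit Types (D : forall i, set 'cV[R]_(k i))
  (g : forall i, 'cV[R]_(k i) -> \bar R)
  (A : 'M[R]_(m1, N)) (b : 'cV[R]_m1) (G : 'M[R]_(m2, N)) (h : 'cV[R]_m2).

Definition feasible D A b G h (x : 'cV[R]_N) :=
  [/\ forall j, ((A *m x)%R j ord0 <= b j ord0)%R, (G *m x)%R = h &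
      forall i, D i (submxcol x i)].

Definition objective g (x : 'cV[R]_N) : \bar R :=
  \sum_(i < n) g i (submxcol x i).

Definition optimal_value D g A b G h : \bar R :=
  ereal_inf [set objective g x | x in feasible D A b G h].

Definition solution D g A b G h (x : 'cV[R]_N) :=
  feasible D A b G h x /\ objective g x = optimal_value D g A b G h.

Definition active A b (x : 'cV[R]_N) : {set 'I_m1} :=
  [set j | (A *m x - b)%R j ord0 == 0%R]%SET.

(* The maximum of #|active A b x| over all x. *)
Definition max_active A b : nat :=
  \max_(c < m1.+1 | `[< exists x, #|active A b x| = c >]) c.

End separable_problem.

Definition involves_two_blocks (R : realType) (n : nat) (k : 'I_n -> nat)
    (m : nat) (A : 'M[R]_(m, (\sum_(i < n) k i)%N)) :=
  forall j : 'I_m, exists i1 i2 : 'I_n,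
    [/\ i1 != i2, row j (submxrow A i1) != 0%R &
        row j (submxrow A i2) != 0%R].

(* Main.v *)
Require Import Defs.
From mathcomp Require Import all_boot all_order all_algebra.
From mathcomp Require Import all_classical all_reals all_analysis.
From mathcomp Require Import ring zify.
Import Order.TTheory GRing.Theory Num.Theory.
Import numFieldNormedType.Exports.
Local Open Scope classical_set_scope.
Local Open Scope ring_scope.
Local Open Scope ereal_scope.

(* By Caratheodory and compactness, the epigraph of the convex envelope of f_i
   is the convex hull of the epigraph of f_i, so every value of the envelope is
   attained by a convex combination of k_i + 1 points of S_i. Hence the
   convexified problem has a solution, given by finitely many atoms in each S_i
   and their weights. With the atoms fixed, the weights solve a linear program;
   a basic solution has at most n + m2 + (number of active inequalities)
   positive weights. Each block needs at least one, so all but at most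
   m1~ + m2 blocks consist of a single atom, where f_i agrees with its
   envelope; the other blocks cost at most rho(f_i) each. *)

Set Implicit Arguments.
Unset Strict Implicit.
Unset Printing Implicit Defensive.

(** * Basic solutions of linear programs *)

(** A matrix with more rows than columns has a nonzero left kernel; a kernel vector is extended by
    zero outside [A]. *)
Lemma dependent_rows (F : fieldType) (I Q : finType) (L : I -> Q -> F)
    (A : {set I}) : (#|Q| < #|A|)%N ->
  exists d : I -> F, [/\ forall i, i \notin A -> d i = 0%R,
    exists i, d i != 0%R & forall q, (\sum_i d i * L i q)%R = 0%R].
Proof.
move=> QA.
pose M := (\matrix_(a < #|A|, b < #|Q|) L (enum_val a) (enum_val b))%R.
have /rowV0Pn [v /sub_kermxP vM v0] : kermx M != 0%R.
  by rewrite kermx_eq0 -row_leq_rank -ltnNge (leq_ltn_trans (rank_leq_col M)).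
(* At most one [a] qualifies, so this is the entry of [v] belonging to [i], or 0 outside [A]. *)
pose d i := (\sum_(a < #|A| | enum_val a == i) v ord0 a)%R.
exists d; split.
- move=> i iA; rewrite /d big1// => a /eqP ai.
  by move: iA; rewrite -ai enum_valP.
- have /rV0Pn [a va] := v0; exists (enum_val a).
  rewrite /d (big_pred1 a)// => a' /=.
  by apply/eqP/eqP => [/enum_val_inj//|->].
- move=> q; have /rowP/(_ (enum_rank q)) := vM.
  rewrite !mxE => E; rewrite -[RHS]E.
  rewrite [RHS](partition_big (@enum_val _ (mem A)) xpredT)//=.
  apply: eq_bigr => i _; rewrite /d mulr_suml.
  by apply: eq_bigr => a /eqP <-; rewrite mxE enum_rankK.
Qed.

(** The ratio test of the simplex method: moving along [d] until the first coordinate reaches 0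
    removes it from the support, and the second hypothesis lets no new coordinate enter. *)
Lemma drop_support (R : realFieldType) (I : finType) (lam d : I -> R) :
    (forall i, 0 <= lam i)%R -> (forall i, lam i = 0%R -> d i = 0%R) ->
    (exists i, d i < 0)%R ->
  exists t : R, [/\ (0 <= t)%R, forall i, (0 <= lam i + t * d i)%R &
    (#|[set i | (lam i + t * d i != 0)%R]%SET| <
      #|[set i | lam i != 0%R]%SET|)%N].
Proof.
move=> lam0 supp [i0 di0].
pose r i := (lam i / - d i)%R.
pose i1 := [arg min_(i < i0 | (d i < 0)%R) r i]%O.
have [di1 ri1] : (d i1 < 0)%R /\ (forall j, (d j < 0)%R -> (r i1 <= r j)%R).
  by rewrite /i1; case: arg_minP => // i di ri; split.
have t0 : (0 <= r i1)%R by rewrite /r divr_ge0// oppr_ge0 ltW.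
have tE : (lam i1 + r i1 * d i1 = 0)%R.
  by rewrite /r invrN mulrN mulNr divfK ?subrr// lt_eqF.
exists (r i1); split => //.
  move=> i; have [di|di] := ltP (d i) 0%R; last by rewrite addr_ge0// mulr_ge0.
  by rewrite -(opprK (d i)) mulrN subr_ge0 -ler_pdivlMr ?oppr_gt0// ri1.
apply: proper_card; apply/properP; split.
  apply/fintype.subsetP => i; rewrite !inE; apply: contraNN => /eqP li.
  by rewrite li supp// mulr0 addr0.
exists i1; rewrite !inE ?tE ?eqxx//.
by apply/eqP => /supp E; move: di1; rewrite E ltxx.
Qed.

(* The first hypothesis says that the feasible set of the linear program has no
   direction of recession, so a move along the kernel hits a facet. *)
Lemma sparse_weights (R : realFieldType) (I Q : finType) (L : I -> Q -> R)
    (c lam : I -> R) :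
    (forall d : I -> R, (forall i, 0 <= d i)%R ->
      (forall q, \sum_i d i * L i q = 0)%R -> forall i, d i = 0%R) ->
    (forall i, 0 <= lam i)%R ->
  exists mu : I -> R, [/\ forall i, (0 <= mu i)%R,
    forall q, (\sum_i mu i * L i q = \sum_i lam i * L i q)%R,
    (\sum_i mu i * c i <= \sum_i lam i * c i)%R &
    (#|[set i | mu i != 0%R]%SET| <= #|Q|)%N].
Proof.
move=> pointed.
have [s] := ubnP #|[set i | lam i != 0%R]%SET|.
elim: s lam => // s IHs lam lams lam0.
have [Q_ge|Q_lt] := leqP #|[set i | lam i != 0%R]%SET| #|Q|;
  first by exists lam.
have [d0 [supp0 [j0 d0j0] ker0]] := dependent_rows L Q_lt.
have [d [suppd [j dj] kerd costd]] : exists d : I -> R,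
    [/\ forall i, i \notin [set i | lam i != 0%R]%SET -> d i = 0%R,
      exists i, d i != 0%R, forall q, (\sum_i d i * L i q)%R = 0%R &
      (\sum_i d i * c i <= 0)%R].
  (* [- d0] lies in the kernel as well, so the sign can be chosen not to raise the cost. *)
  have [c0|c0] := leP (\sum_i d0 i * c i)%R 0%R.
    by exists d0; split => //; exists j0.
  exists (fun i => - d0 i)%R; split.
  - by move=> i /supp0 ->; rewrite oppr0.
  - by exists j0; rewrite oppr_eq0.
  - by move=> q; under eq_bigr do rewrite mulNr; rewrite sumrN ker0 oppr0.
  - by under eq_bigr do rewrite mulNr; rewrite sumrN oppr_le0 ltW.
have neg : exists i, (d i < 0)%R.
  apply: contrapT => Nneg; move: dj; rewrite pointed ?eqxx// => i.
  by rewrite leNgt; apply/negP => di; apply: Nneg; exists i.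
have suppd' i : lam i = 0%R -> d i = 0%R.
  by move=> li; apply: suppd; rewrite inE li eqxx.
have [t [t0 nu0 nus]] := drop_support lam0 suppd' neg.
have sumE (e : I -> R) :
    (\sum_i (lam i + t * d i) * e i
     = \sum_i lam i * e i + t * \sum_i d i * e i)%R.
  rewrite mulr_sumr -big_split/=; apply: eq_bigr => i _.
  by rewrite mulrDl mulrA.
have [|mu [mu0 muL muc muQ]] := IHs (fun i => lam i + t * d i)%R _ nu0.
  exact: leq_trans nus lams.
exists mu; split => //.
- by move=> q; rewrite muL sumE kerd mulr0 addr0.
- by apply: le_trans muc _; rewrite sumE gerDl mulr_ge0_le0.
Qed.

(** * Minimization over finitely many weighted atoms *)

(** The sets [B i] generate a proper filter on the compact [K]; a cluster point lies in each of them
    because they are closed. *)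
Lemma compact_directed_inter (T : topologicalType) (I : Type) (K : set T)
    (B : I -> set T) : compact K -> inhabited I ->
    (forall i, closed (B i)) -> (forall i, B i `<=` K) ->
    (forall i, B i !=set0) ->
    (forall i j, exists l, B l `<=` B i `&` B j) ->
  exists p, forall i, B i p.
Proof.
move=> Kc [i0] Bcl BK B0 BI.
have PF : ProperFilter (filter_from setT B).
  apply: filter_from_proper => //; apply: filter_from_filter.
    by exists i0.
  by move=> i j _ _; have [l Bl] := BI i j; exists l.
have [|p [_ clp]] := Kc _ PF; first by exists i0 => //; exact: BK.
exists p => i; apply: Bcl => C Cp.
by apply: clp => //; exists i.
Qed.

Section atoms.
Context (R : realType) (J : finType) (E : J -> normedModType R).
Context (S : forall j, set (E j)) (f : forall j, E j -> R).
Arguments S : clear implicits.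
Arguments f : clear implicits.
Hypothesis S_compact : forall j, compact (S j).
Hypothesis f_lsc : forall j,
  lower_semicontinuous (EFin \o f j : subspace (S j) -> \bar R).

(** Each index carries a weight and a position; the product topology makes Tychonoff's theorem
    available. *)
Definition atoms : topologicalType := prod_topology (fun j => (R * E j)%type).

Definition atoms_in : set atoms :=
  [set p | forall j, (`[0%R, 1%R] `*` S j) (p j)].

Definition cost (p : atoms) : R := (\sum_j (p j).1 * f j (p j).2)%R.

Lemma weight_continuous j : continuous (fun p : atoms => (p j).1).
Proof.
move=> p; apply: (@continuous_comp _ _ _ (fun p : atoms => p j) fst).
  exact: (@proj_continuous _ (fun j => (R * E j)%type) j p).
exact: cvg_fst.
Qed.

Lemma atom_continuous j : continuous (fun p : atoms => (p j).2).
Proof.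
move=> p; apply: (@continuous_comp _ _ _ (fun p : atoms => p j) snd).
  exact: (@proj_continuous _ (fun j => (R * E j)%type) j p).
exact: cvg_snd.
Qed.

Lemma atoms_in_compact : compact atoms_in.
Proof.
apply: (@tychonoff J (fun j => (R * E j)%type)
  (fun j => `[0%R, 1%R] `*` S j)) => j.
by apply: compact_setX; [exact: segment_compact|exact: S_compact].
Qed.

Lemma atoms_in_closed : closed atoms_in.
Proof.
apply: compact_closed; last exact: atoms_in_compact.
apply: hausdorff_product => j; exact: (@norm_hausdorff R (R * E j)%type).
Qed.

(** Lower semicontinuity of the cost. Near [p], since weights are nonnegative, each [f j] may be
    replaced from below by the constant [a j], and the resulting sum is continuous in the
    weights. *)
Lemma cost_sublevel_closed t : closed (atoms_in `&` [set p | (cost p <= t)%R]).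
Proof.
move=> p clp.
have Pp : atoms_in p by apply: atoms_in_closed; apply: closureS clp => q [].
split => //=; apply/ler_addgt0Pr => e e0.
(* Weights are at most 1, so lowering every [f j] by [e'] loses at most [e]; the successor avoids
   dividing by 0 when [J] is empty. *)
pose e' := (e / (#|J|.+1)%:R)%R.
have e'0 : (0 < e')%R by rewrite divr_gt0.
pose a j := (f j (p j).2 - e')%R.
have near_fj j : \forall q \near p, S j (q j).2 -> (a j < f j (q j).2)%R.
  have Sp : S j (p j).2 by have [] := Pp j.
  have [|V Vp Vf] := @f_lsc j (p j).2 (a j).
    by rewrite lte_fin ltrBlDr ltrDl.
  move: Vp; rewrite /nbhs/= -(nbhs_subspace_in Sp) => Vp.
  have : \forall q \near p, S j (q j).2 -> V (q j).2.
    exact: (@atom_continuous j p _ Vp).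
  apply: filterS => q Vq Sq.
  by rewrite -lte_fin; apply: Vf; exact: Vq.
have near_f := filter_forall (nbhs_filter p) near_fj.
have : closed [set q : atoms | (\sum_j (q j).1 * a j <= t)%R].
  apply: (preimage_closed (D := [set x | (x <= t)%R])); last exact: closed_le.
  move=> q _; apply: (continuous_big (op := +%R)); first exact: add_continuous.
  by move=> j _ r; exact: (cvgM (@weight_continuous j r) (cvg_cst _)).
move=> /(_ p) pH.
have {}pH : (\sum_j (p j).1 * a j <= t)%R.
  apply: pH => C /(filterI near_f)/clp [q [[Pq qt] [fq Cq]]].
  exists q; split => //=; apply: le_trans qt; apply: ler_sum => j _.
  have [/andP[q0 _] Sq] := Pq j.
  by rewrite ler_wpM2l// ltW// fq.
apply: (@le_trans _ _ (\sum_j (p j).1 * a j + e)%R); last by rewrite lerD2r.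
rewrite -lerBlDl -sumrB.
have -> : (\sum_i ((p i).1 * f i (p i).2 - (p i).1 * a i) =
    (\sum_i (p i).1) * e')%R.
  rewrite mulr_suml; apply: eq_bigr => j _.
  by rewrite -mulrBr /a opprB addrC subrK.
rewrite /e' mulrA ler_pdivrMr// mulrC ler_wpM2l// ?(ltW e0)//.
apply: (@le_trans _ _ (\sum_(j : J) 1)%R).
  by apply: ler_sum => j _; have [/andP[_ ?]] := Pp j.
by rewrite sumr_const ler_nat.
Qed.

(** A minimizer is a common point of the sublevel sets at the costs of all candidates, which are
    closed, nonempty and nested. *)
Lemma cost_attains_min (Q : set atoms) : closed Q ->
    atoms_in `&` Q !=set0 ->
  exists2 p, (atoms_in `&` Q) p &
    forall q, (atoms_in `&` Q) q -> (cost p <= cost q)%R.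
Proof.
move=> Qcl [q0 Pq0].
pose B (q : {q | (atoms_in `&` Q) q}) : set atoms :=
  (atoms_in `&` Q) `&` [set p | (cost p <= cost (sval q))%R].
have [|||||p Bp] := @compact_directed_inter _ _ atoms_in B atoms_in_compact.
- by split; exists q0.
- move=> q; rewrite /B setIAC; apply: closedI => //.
  exact: cost_sublevel_closed.
- by move=> q p [[]].
- by move=> q; exists (sval q); split; [exact: svalP|exact: lexx].
- move=> q r; have [qr|rq] := leP (cost (sval q)) (cost (sval r)).
    by exists q => p [Pp pq]; split; split => //; exact: le_trans qr.
  by exists r => p [Pp pr]; split; split => //; apply: le_trans (ltW rq).
- exists p; first by have [] := Bp (exist _ q0 Pq0).
  by move=> q Pq; have [_] := Bp (exist _ q Pq).
Qed.

End atoms.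

(** * Convex combinations and the convex envelope *)

Lemma convex_set_comb (R : realType) (V : lmodType R)
    (A : set (convex_lmodType V)) (x y : V) (t : R) : convex_set A ->
  (0 <= t <= 1)%R -> A x -> A y -> A (t *: x + (1 - t) *: y)%R.
Proof.
move=> Ac /andP[t0 t1] Ax Ay.
have := Ac x y (Itv01 t0 t1); rewrite !inE; exact.
Qed.

Lemma convex_set_sum (R : realType) (V : lmodType R)
    (A : set (convex_lmodType V)) (I : finType) (lam : I -> R) (y : I -> V) :
    convex_set A -> (forall i, 0 <= lam i)%R -> (\sum_i lam i = 1)%R ->
    (forall i, A (y i)) -> A (\sum_i lam i *: y i)%R.
Proof.
move=> Ac lam0 lam1 Ay.
(* The induction runs on partial sums normalized by their own total weight. *)
suff H (s : seq I) : (0 < \sum_(i <- s) lam i)%R ->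
    A ((\sum_(i <- s) lam i)^-1 *: \sum_(i <- s) lam i *: y i)%R.
  by have := H (index_enum I); rewrite lam1 invr1 scale1r; exact.
elim: s => [|x s IHs]; first by rewrite big_nil ltxx.
rewrite !big_cons; set c := (\sum_(i <- s) _)%R => c0.
have c_ge0 : (0 <= c)%R by apply: sumr_ge0.
(* A tail of total weight 0 consists of zero terms only. *)
have [cE|cN] := eqVneq c 0%R.
  rewrite [X in (_ *: (_ + X))%R]big1_seq ?addr0; last first.
    move=> i /= is_; move: cE; rewrite /c => /eqP.
    rewrite psumr_eq0// => /allP/(_ i is_)/= /eqP ->; exact: scale0r.
  by rewrite cE addr0 in c0 *; rewrite scalerA mulVf ?gt_eqF// scale1r.
have {}cN : (0 < c)%R by rewrite lt_def cN.
have := convex_set_comb (t := lam x / (lam x + c)) Ac _ (Ay x) (IHs cN).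
rewrite scalerDr !scalerA [X in (_ + X *: _)%R](_ : _ = (lam x + c)^-1)%R.
  rewrite [X in (X *: y x)%R]mulrC; apply; apply/andP; split.
    by rewrite mulr_ge0// invr_ge0 ltW.
  by rewrite ler_pdivrMr// mul1r lerDl.
by rewrite -/c; field; rewrite !gt_eqF.
Qed.

Lemma convex_conv_hull (R : realType) (V : lmodType R) (S : set V) :
  convex_set (conv_hull S).
Proof.
move=> x y t; rewrite !inE => Sx Sy B [Bc SB].
by have := Bc x y t; rewrite !inE; apply; [apply: Sx|apply: Sy].
Qed.

Section combination.
Context (R : realType) (V : normedModType R) (S : set V) (f : V -> R).

(** The last condition is an inequality, so that the pairs [(x, t)] are closed upwards in [t], like
    an epigraph. *)
Definition combination (I : finType) (lam : I -> R) (y : I -> V) (x : V)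
    (t : R) :=
  [/\ forall i, (0 <= lam i)%R, (\sum_i lam i = 1)%R, forall i, S (y i),
    (\sum_i lam i *: y i)%R = x & (\sum_i lam i * f (y i) <= t)%R].

(* The convex hull of the epigraph of f over S. *)
Definition combinations : set (V * R^o) :=
  [set p | exists (I : finType) (lam : I -> R) (y : I -> V),
    combination lam y p.1 p.2].

Lemma combinations_point x : S x -> combinations (x, f x).
Proof.
move=> Sx; exists unit, (fun=> 1%R), (fun=> x); split => //=;
  rewrite big_const card_unit /= addr0 ?scale1r//.
by rewrite mul1r.
Qed.

(** Two combinations merge into one over the disjoint union of their index types, with weights
    scaled by [u] and [1 - u]. *)
Lemma convex_combinations : convex_set combinations.
Proof.
move=> [x t] [x' t'] u; rewrite !inE => -[I [lam [y [lam0 lam1 Sy /= yx ft]]]].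
move=> [I' [lam' [y' [lam0' lam1' Sy' /= yx' ft']]]].
exists (I + I')%type, (fun i => match i with
  | inl i => u%:num * lam i | inr i => (1 - u%:num) * lam' i end)%R,
  (fun i => match i with inl i => y i | inr i => y' i end).
split => /=.
- by case=> i; rewrite mulr_ge0.
- by rewrite big_sumType/= -!mulr_sumr lam1 lam1' !mulr1 addrC subrK.
- by case.
- rewrite big_sumType/= -yx -yx' /= !scaler_sumr.
  by congr (_ + _)%R; apply: eq_bigr => i _; rewrite scalerA.
- rewrite big_sumType/=; apply: lerD; rewrite [leRHS]/GRing.scale/=.
    under eq_bigr do rewrite -mulrA; rewrite -mulr_sumr; exact: ler_wpM2l.
  by under eq_bigr do rewrite -mulrA; rewrite -mulr_sumr; exact: ler_wpM2l.
Qed.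

Lemma conv_hull_combinations x : conv_hull S x -> exists t, combinations (x, t).
Proof.
move=> /(_ [set x | exists t, combinations (x, t)]); apply; split.
  move=> z z' u; rewrite !inE => -[t Ct] [t' Ct'].
  exists (conv u t t').
  by have := @convex_combinations (z, t) (z', t') u; rewrite !inE; apply.
by move=> z Sz; exists (f z); exact: combinations_point.
Qed.

Lemma combination_conv_hull (I : finType) (lam : I -> R) (y : I -> V) x t :
  combination lam y x t -> conv_hull S x.
Proof.
move=> [lam0 lam1 Sy <- _]; apply: convex_set_sum => //.
  exact: convex_conv_hull.
by move=> i B [_]; apply; exact: Sy.
Qed.

(** The epigraph of [g] contains every [(y i, f (y i))] and hence, being convex, their weighted
    mean. *)
Lemma closed_convex_le_combination (g : V -> \bar R) x t :
  closed_convex g -> majorized g (extend S (EFin \o f)) ->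
  combinations (x, t) -> g x <= t%:E.
Proof.
move=> [_ gc _] gf [I [lam [y [lam0 lam1 Sy /= yx ft]]]].
have gy i : epigraph g (y i, f (y i)).
  by apply: le_trans (gf (y i)) _; rewrite /extend patchT// inE.
have := convex_set_sum gc lam0 lam1 gy.
rewrite /epigraph/= (big_morph fst (id1 := 0%R) (op1 := +%R))//.
rewrite (big_morph snd (id1 := 0%R) (op1 := +%R))//= yx => /le_trans; apply.
by rewrite lee_fin.
Qed.

Lemma convex_envelope_le_combination x t :
  combinations (x, t) -> convex_envelope (extend S (EFin \o f)) x <= t%:E.
Proof.
move=> xt; apply: ge_ereal_sup => _ [g [gc gf] <-].
exact: closed_convex_le_combination xt.
Qed.

Lemma fhat_le_combination (I : finType) (lam : I -> R) (y : I -> V) x t :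
  combination lam y x t -> fhat S f x <= t%:E.
Proof.
move=> c; rewrite /fhat /extend patchT.
  by apply: convex_envelope_le_combination; exists I, lam, y.
by rewrite inE; exact: combination_conv_hull c.
Qed.

End combination.

(** * Caratheodory's theorem and closedness of the hull of the epigraph *)

Section caratheodory.
Context (R : realType) (k : nat) (S : set 'cV[R]_k) (f : 'cV[R]_k -> R).

(** [sparse_weights], with one row per coordinate and the row [None] for the total weight, leaves at
    most [k.+1] positive weights without raising the cost. The rest is reindexing by ['I_k.+1]. *)
Lemma caratheodory x t : combinations S f (x, t) ->
  exists lam (y : 'I_k.+1 -> 'cV[R]_k), combination S f lam y x t.
Proof.
move=> [I [lam [y [lam0 lam1 Sy /= yx ft]]]].
pose L i (q : option 'I_k) := if q is Some l then y i l ord0 else 1%R.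
have [|mu [mu0 muL muf muQ]] := @sparse_weights _ _ _ L (f \o y) lam _ lam0.
  move=> d d0 /(_ None); under eq_bigr do rewrite mulr1.
  move=> /eqP; rewrite psumr_eq0// => /allP d_eq0 i.
  by have /= := d_eq0 i (mem_index_enum i) => /eqP.
have mu1 : (\sum_i mu i = 1)%R.
  have := muL None; under eq_bigr do rewrite mulr1.
  by under [RHS]eq_bigr do rewrite mulr1; rewrite lam1.
have {muL} muy : (\sum_i mu i *: y i = x)%R.
  rewrite -yx; apply/colP => l; rewrite !summxE.
  have /= E := muL (Some l).
  by under eq_bigr do rewrite mxE; under [RHS]eq_bigr do rewrite mxE.
have [i0 _] : exists i0 : I, True.
  apply: contrapT => I0; suff : (\sum_i lam i = 0)%R.
    by move/eqP; rewrite lam1 oner_eq0.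
  by rewrite big1// => i; case: I0; exists i.
pose A := [set i | mu i != 0%R]%SET.
have sA : (size (enum A) <= k.+1)%N.
  by rewrite -cardE (leq_trans muQ)// card_option card_ord.
(* [r] is injective on the support only; elsewhere the weights are 0 and collisions are harmless. *)
pose r i : 'I_k.+1 := inord (index i (enum A)).
have r_inj i i' : mu i != 0%R -> mu i' != 0%R -> r i = r i' -> i = i'.
  have iA i1 : mu i1 != 0%R -> i1 \in enum A by rewrite mem_enum inE.
  move=> /iA Ai /iA Ai' /(congr1 val) /=; rewrite !inordK.
  - by move=> /index_inj ->.
  - by rewrite (leq_trans _ sA)// index_mem.
  - by rewrite (leq_trans _ sA)// index_mem.
pose lam' j := (\sum_(i | r i == j) mu i)%R.
(* An index hit by no support point gets weight 0; [y i0] merely keeps [y' j] in [S]. *)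
pose y' j := if [pick i | (mu i != 0%R) && (r i == j)] is Some i then y i
             else y i0.
(* A general module [W] covers both the barycenter and, with [R^o], the cost. *)
have sumE (W : lmodType R) (F : 'cV[R]_k -> W) :
    (\sum_j lam' j *: F (y' j) = \sum_i mu i *: F (y i))%R.
  rewrite [RHS](partition_big r xpredT)//=; apply: eq_bigr => j _.
  rewrite scaler_suml; apply: eq_bigr => i /eqP rij.
  have [->|mui] := eqVneq (mu i) 0%R; first by rewrite !scale0r.
  rewrite /y'; case: pickP => [i' /andP[mui' /eqP ri'j]|/(_ i)].
    by rewrite (r_inj i' i)// rij.
  by rewrite mui rij eqxx.
exists lam', y'; split.
- by move=> j; apply: sumr_ge0.
- by rewrite -mu1 [RHS](partition_big r xpredT).
- by move=> j; rewrite /y'; case: pickP => [i|] _; exact: Sy.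
- by rewrite -muy; exact: (sumE _ id).
- have -> : (\sum_j lam' j * f (y' j) = \sum_i mu i * f (y i))%R.
    exact: (sumE R^o f).
  exact: le_trans muf ft.
Qed.

Hypothesis S_compact : compact S.
Hypothesis f_lsc : lower_semicontinuous (EFin \o f : subspace S -> \bar R).

Local Notation T := (atoms (fun _ : 'I_k.+1 => 'cV[R]_k)).
Local Notation S_ := (fun _ : 'I_k.+1 => S).
Local Notation f_ := (fun _ : 'I_k.+1 => f).

Definition weighted_atoms (x : 'cV[R]_k) : set T :=
  [set p | (\sum_j (p j).1 = 1)%R /\ (\sum_j (p j).1 *: (p j).2 = x)%R].

Lemma atoms_of_combination (lam : 'I_k.+1 -> R) y x t :
  combination S f lam y x t ->
  let p : T := fun j => (lam j, y j) in
  [/\ atoms_in S_ p, weighted_atoms x p & (cost f_ p <= t)%R].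
Proof.
move=> [lam0 lam1 Sy yx ft] p; split => // j; split => //=.
rewrite in_itv/= lam0 -lam1 (bigD1 j)//= lerDl.
exact: sumr_ge0.
Qed.

Lemma combination_of_atoms (p : T) x t : atoms_in S_ p -> weighted_atoms x p ->
  (cost f_ p <= t)%R ->
  combination S f (fun j => (p j).1) (fun j => (p j).2) x t.
Proof.
by move=> Sp [p1 px] pt; split => // j; have [/andP[]] := Sp j.
Qed.

Lemma sum_weight_continuous :
  continuous (fun p : T => \sum_j (p j).1)%R.
Proof.
apply: (continuous_big (op := +%R)) => [|j _]; first exact: add_continuous.
exact: (@weight_continuous _ _ (fun=> 'cV[R]_k) j).
Qed.

Lemma barycenter_continuous :
  continuous (fun p : T => \sum_j (p j).1 *: (p j).2)%R.
Proof.
apply: (continuous_big (op := +%R)) => [|j _ p]; first exact: add_continuous.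
exact: (cvgZ (@weight_continuous _ _ (fun=> 'cV[R]_k) j p)
             (@atom_continuous _ _ (fun=> 'cV[R]_k) j p)).
Qed.

(** By Caratheodory, the combinations approximating [(x, t)] all live in one compact space of [k.+1]
    atoms. The sets [B e], which allow an error [e] in cost and barycenter, have a common point
    there, and it represents [(x, t)] exactly. *)
Lemma closed_combinations : closed (combinations S f).
Proof.
move=> [x t] clxt.
pose B (e : {posnum R}) : set T :=
  atoms_in S_ `&` [set p | cost f_ p <= t + e%:num]%R
  `&` ((fun p : T => \sum_j (p j).1)%R @^-1` [set 1%R])
  `&` ((fun p : T => `|\sum_j (p j).1 *: (p j).2 - x|)%R
    @^-1` [set r | (r <= e%:num)%R]).
have [||||||p Bp] := @compact_directed_inter _ _ (atoms_in S_) B.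
- exact: atoms_in_compact.
- by split; exact: (1%:pos)%R.
- move=> e; apply: closedI; first apply: closedI.
  + exact: cost_sublevel_closed.
  + apply: preimage_closed => [p _|]; first exact: sum_weight_continuous.
    exact: closed_eq.
  + apply: preimage_closed => [p _|]; last exact: closed_le.
    exact: (cvg_norm (cvgB (@barycenter_continuous p) (cvg_cst x))).
- by move=> e p [[[]]].
- move=> e.
  have [|[x' t'] [/= /caratheodory[lam [y c]] [/= xx' tt']]] :=
      clxt (ball (x, t) e%:num).
    exact: nbhsx_ballx.
  have [Sp [p1 px] pt] := atoms_of_combination c.
  exists (fun j => (lam j, y j)); split; first split => //.
    split => //=; apply: le_trans pt _; rewrite -lerBlDl ltW//.
    move: tt'; rewrite /ball/= distrC; apply: le_lt_trans; exact: ler_norm.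
  move: xx'; rewrite -ball_normE/= px distrC => /ltW; exact.
- move=> e e'; exists ((Num.min e%:num e'%:num)%:pos)%R => p.
  move=> [[[Sp pt] p1] px].
  split; (split; first split => //; first split => //=).
  + by apply: le_trans pt _; rewrite lerD2l ge_min lexx.
  + by apply: le_trans px _; rewrite ge_min lexx.
  + by apply: le_trans pt _; rewrite lerD2l ge_min lexx orbT.
  + by apply: le_trans px _; rewrite ge_min lexx orbT.
exists 'I_k.+1, (fun j => (p j).1), (fun j => (p j).2).
apply: combination_of_atoms => //=.
- by have [[[]]] := Bp (1%:pos)%R.
- split; first by have [[]] := Bp (1%:pos)%R.
  apply/eqP; rewrite -subr_eq0 -normr_le0; apply/ler_addgt0Pr => e e0.
  by rewrite add0r; have [_] := Bp (PosNum e0).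
- apply/ler_addgt0Pr => e e0.
  by have [[[_]]] := Bp (PosNum e0).
Qed.

End caratheodory.

(** * Attainment of the envelope by finitely many atoms *)

Section envelope_attained.
Context (R : realType) (k : nat) (S : set 'cV[R]_k) (f : 'cV[R]_k -> R).
Hypothesis S_compact : compact S.
Hypothesis f_lsc : lower_semicontinuous (EFin \o f : subspace S -> \bar R).

Local Notation T := (atoms (fun _ : 'I_k.+1 => 'cV[R]_k)).
Local Notation S_ := (fun _ : 'I_k.+1 => S).
Local Notation f_ := (fun _ : 'I_k.+1 => f).

Lemma closed_weighted_atoms (x : 'cV[R]_k) : closed (weighted_atoms x).
Proof.
rewrite (_ : weighted_atoms x =
  (fun p : T => \sum_j (p j).1)%R @^-1` [set 1%R] `&`
  (fun p : T => \sum_j (p j).1 *: (p j).2)%R @^-1` [set x])//.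
apply: closedI.
  apply: preimage_closed => [p _|]; last exact: closed_eq.
  exact: sum_weight_continuous.
apply: preimage_closed => [p _|].
  exact: barycenter_continuous.
exact: (accessible_closed_set1 (hausdorff_accessible (@norm_hausdorff _ _))).
Qed.

Lemma combinations_min x t : combinations S f (x, t) ->
  exists p : T, [/\ atoms_in S_ p, weighted_atoms x p &
    forall t', combinations S f (x, t') -> (cost f_ p <= t')%R].
Proof.
move=> /caratheodory[lam [y /atoms_of_combination[Sp px pt]]].
have [|p [Sp' px'] p_min] := @cost_attains_min _ _ _ S_ f_ (fun=> S_compact)
    (fun=> f_lsc) _ (closed_weighted_atoms (x := x)).
  by eexists; split; [exact: Sp|exact: px].
exists p; split => // t'.
move=> /caratheodory[lam' [y' /atoms_of_combination[Sq qx qt]]].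
by apply: le_trans qt; exact: p_min.
Qed.

(** Every combination bounds the envelope from above. Conversely, the least cost [g] is itself
    closed, convex and majorized by [f], so it lies below the envelope. *)
Lemma envelope_attained x : conv_hull S x ->
  exists p : T, [/\ atoms_in S_ p, weighted_atoms x p &
    fhat S f x = (cost f_ p)%:E].
Proof.
move=> Sx; have [t xt] := conv_hull_combinations f Sx.
have [p [Sp px p_min]] := combinations_min xt.
exists p; split => //.
have pc := combination_of_atoms Sp px (lexx (cost f_ p)).
apply/eqP; rewrite eq_le (fhat_le_combination pc)/=.
pose g z := ereal_inf [set t%:E | t in [set t | combinations S f (z, t)]].
have g_ge z (q : T) :
    (forall t', combinations S f (z, t') -> cost f_ q <= t')%R ->
    (cost f_ q)%:E <= g z.
  by move=> qt; apply: le_ereal_inf_tmp => _ [t' /qt ? <-]; rewrite lee_fin.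
(* The infimum is attained wherever it is not over the empty set; this makes the epigraph of [g]
   equal to [combinations S f], whose convexity and closedness are known. *)
have g_spec z : g z = +oo \/ exists q : T, [/\ atoms_in S_ q,
    weighted_atoms z q & (cost f_ q)%:E <= g z].
  have [[t' zt']|Nz] := pselect (exists t, combinations S f (z, t)).
    right; have [q [Sq qz q_min]] := combinations_min zt'.
    by exists q; split => //; exact: g_ge.
  left; rewrite /g [X in ereal_inf X](_ : _ = set0) ?ereal_inf0//.
  by rewrite -subset0 => ? [t' zt' _]; apply: Nz; exists t'.
have epig : epigraph g = combinations S f.
  apply/seteqP; split => [[z s]|[z s] zs] /=; rewrite /epigraph/=.
    have [->|[q [Sq qz qg]]] := g_spec z; first by rewrite leye_eq.
    move=> /(le_trans qg); rewrite lee_fin => qs.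
    exists 'I_k.+1, (fun j => (q j).1), (fun j => (q j).2).
    exact: combination_of_atoms.
  by apply: ereal_inf_lbound; exists s.
rewrite /fhat /extend patchT ?inE//.
apply: (le_trans (g_ge _ _ p_min)); apply: ereal_sup_ubound; exists g => //.
split.
  split; rewrite ?epig.
  - move=> z; have [->//|[q [_ _]]] := g_spec z.
    by rewrite -ltNye; apply: lt_le_trans; rewrite ltNyr.
  - exact: convex_combinations.
  - exact: closed_combinations.
move=> z; rewrite /extend /patch; case: ifPn => [/set_mem Sz|_].
  by apply: ereal_inf_lbound; exists (f z) => //; exact: combinations_point.
exact: leey.
Qed.

End envelope_attained.

(** * Nonconvexity *)

Lemma fhat_majorized (R : realType) (V : normedModType R) (S : set V)
    (f : V -> R) : majorized (fhat S f) (extend S (EFin \o f)).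
Proof.
move=> x; rewrite [leRHS]/extend /patch; case: ifPn => [/set_mem Sx|_].
  have [I [lam [y c]]] := combinations_point f Sx.
  exact: fhat_le_combination c.
exact: leey.
Qed.

(** Every point contributes a nonnegative difference, by [fhat_majorized] or by the convention for
    two infinite values; the origin is a point that always exists. *)
Lemma nonconvexity_ge0 (R : realType) (V : normedModType R) (S : set V)
    (f : V -> R) : 0 <= nonconvexity S f.
Proof.
apply: (@le_trans _ _ (sube_pinfty0 (extend S (EFin \o f) 0%R)
  (fhat S f 0%R))); last by apply: ereal_sup_ubound; exists 0%R.
rewrite /sube_pinfty0; case: ifPn => //.
have := @fhat_majorized _ _ S f 0%R.
have : extend S (EFin \o f) 0%R != -oo by rewrite /extend /patch; case: ifP.
case: (extend S _ 0%R) => [a|//|//] _; case: (fhat S f 0%R) => [b|//|//] //=.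
1: by rewrite !lee_fin subr_ge0.
all: by rewrite ?addey ?addye ?leey.
Qed.

Lemma extend_le_fhatD (R : realType) (V : normedModType R) (S : set V)
    (f : V -> R) x : fhat S f x \is a fin_num ->
  extend S (EFin \o f) x <= fhat S f x + nonconvexity S f.
Proof.
move=> fin; rewrite -leeBlDl//; apply: ereal_sup_ubound; exists x => //.
by rewrite /sube_pinfty0; case: (fhat S f x) fin => // r _; rewrite andbF.
Qed.

(** An exchange argument: outside the common part of [B] and the initial segment [D], terms of [B]
    are at most [v] and terms of [D] at least [v], and [D] has no fewer of them. *)
Lemma sum_le_initial (R : realDomainType) (n c : nat) (r : 'I_n -> \bar R)
    (B : {set 'I_n}) :
    (forall i, 0 <= r i) -> (forall i j : 'I_n, (i <= j)%N -> r j <= r i) ->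
    (#|B| <= c)%N ->
  \sum_(i in B) r i <= \sum_(i < n | (i < c)%N) r i.
Proof.
move=> r0 r_sorted Bc.
pose D := [set i : 'I_n | (i < c)%N]%SET.
rewrite [leRHS](eq_bigl (fun i => i \in D)) => [|i]; last by rewrite inE.
have [nc|cn] := leqP n c.
  apply: lee_sum_nneg_subset => // i _.
  by rewrite !inE (leq_trans (ltn_ord i)).
rewrite (big_setID D)/= [leRHS](big_setID B)/= finset.setIC leeD2l//.
pose v := r (Ordinal cn).
apply: (@le_trans _ _ (\sum_(i in B :\: D) v)).
  apply: lee_sum => i; rewrite !inE -leqNgt => /andP[ci _].
  exact: r_sorted.
apply: (@le_trans _ _ (\sum_(i in D :\: B) v)); last first.
  apply: lee_sum => i; rewrite !inE => /andP[_ /ltnW ic].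
  exact: r_sorted.
have cardD : #|D| = c.
  rewrite -sum1_card -[RHS]subn0 -[RHS]muln1 -sum_nat_const_nat big_mkord
    (big_ord_widen n (fun=> 1%N) (ltnW cn)).
  by apply: eq_bigl => i; rewrite inE.
have BD : (#|B :\: D| <= #|D :\: B|)%N.
  have := Bc; rewrite -[in X in (_ <= X)%N]cardD -(cardsID D B) -(cardsID B D).
  by rewrite finset.setIC leq_add2l.
(* The surplus copies of [v] on the right are nonnegative. *)
rewrite !sumr_const -(subnK BD) mulrnDr leeDr//.
elim: (_ - _)%N => // m IHm; rewrite mulrS adde_ge0//; exact: r0.
Qed.

(** * The separable problem *)

Section separable.
Context (R : realType) (n : nat) (k : 'I_n -> nat).
Context (S : forall i : 'I_n, set 'cV[R]_(k i)).
Context (f : forall i : 'I_n, 'cV[R]_(k i) -> R).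
Context (m1 m2 : nat).
Context (A : 'M[R]_(m1, (\sum_(i < n) k i)%N)) (b : 'cV[R]_m1).
Context (G : 'M[R]_(m2, (\sum_(i < n) k i)%N)) (h : 'cV[R]_m2).
Arguments S : clear implicits.
Arguments f : clear implicits.

(** All atoms of all blocks, as many per block as Caratheodory requires. *)
Local Notation J := {i : 'I_n & 'I_(k i).+1}.
Local Notation atom := (Tagged (fun i : 'I_n => 'I_(k i).+1)).
Local Notation E := (fun j : J => 'cV[R]_(k (tag j))).
Local Notation S_ := (fun j : J => S (tag j)).
Local Notation f_ := (fun j : J => f (tag j)).
Local Notation rows := ('I_n + ('I_m1 + 'I_m2))%type.

Lemma big_tagged (W : nmodType) (F : J -> W) :
  (\sum_j F j = \sum_i \sum_(a < (k i).+1) F (atom a))%R.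
Proof.
by rewrite sig_big_dep/=; apply: eq_bigr => -[i a].
Qed.

(* The coefficient of the weight of an atom y of block tag j in the linear
   constraints "the weights of each block add up to 1", A x <= b and G x = h. *)
Definition coef (q : rows) (j : J) (y : E j) : R :=
  match q with
  | inl i => (tag j == i)%:R
  | inr (inl l) => (submxrow A (tag j) *m y)%R l ord0
  | inr (inr l) => (submxrow G (tag j) *m y)%R l ord0
  end.

Definition row_sum (w : J -> R) (y : forall j, E j) (q : rows) : R :=
  (\sum_j w j * coef q (y j))%R.

Definition block (w : J -> R) (y : forall j, E j) (i : 'I_n) : 'cV[R]_(k i) :=
  (\sum_(a < (k i).+1) w (atom a) *: (y (atom a) : 'cV[R]_(k i)))%R.

Definition barycenter w y : 'cV[R]_(\sum_(i < n) k i)%N :=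
  (\mxcol_i block w y i)%R.

Definition block_cost (w : J -> R) (y : forall j, E j) (i : 'I_n) : R :=
  (\sum_(a < (k i).+1) w (atom a) * f i (y (atom a)))%R.

Definition admissible (w : J -> R) (y : forall j, E j) :=
  [/\ forall i, row_sum w y (inl i) = 1%R,
    forall l, (row_sum w y (inr (inl l)) <= b l ord0)%R &
    forall l, row_sum w y (inr (inr l)) = h l ord0].

Lemma row_sum_block w y i :
  row_sum w y (inl i) = (\sum_(a < (k i).+1) w (atom a))%R.
Proof.
rewrite /row_sum big_tagged (bigD1 i)//= [X in (_ + X)%R]big1 ?addr0.
  by apply: eq_bigr => a _; rewrite eqxx mulr1.
by move=> i' /negbTE ii'; apply: big1 => a _; rewrite ii' mulr0.
Qed.

Lemma mulmx_barycenter (m : nat) (M : 'M[R]_(m, (\sum_(i < n) k i)%N)) w y l :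
  (M *m barycenter w y)%R l ord0 =
  (\sum_(j : J) w j * (submxrow M (tag j) *m y j)%R l ord0)%R.
Proof.
rewrite -[M in LHS]submxrowK /barycenter mul_mxrow_mxcol summxE big_tagged.
apply: eq_bigr => i _; rewrite /block mulmx_sumr summxE.
by apply: eq_bigr => a _; rewrite -scalemxAr mxE.
Qed.

Lemma row_sumA w y l :
  row_sum w y (inr (inl l)) = (A *m barycenter w y)%R l ord0.
Proof. by rewrite mulmx_barycenter. Qed.

Lemma row_sumG w y l :
  row_sum w y (inr (inr l)) = (G *m barycenter w y)%R l ord0.
Proof. by rewrite mulmx_barycenter. Qed.

(** From atoms to the convexified problem without raising the cost; [feasible_atoms] goes back with
    equal cost, so both minimizations have the same value. *)
Lemma admissible_feasible w y : (forall j, 0 <= w j)%R ->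
    (forall j, S_ j (y j)) -> admissible w y ->
  feasible (fun i => conv_hull (S i)) A b G h (barycenter w y) /\
  forall i, fhat (S i) (f i) (submxcol (barycenter w y) i) <=
    (block_cost w y i)%:E.
Proof.
move=> w0 Sy [w1 wA wG].
have comb i : combination (S i) (f i) (fun a => w (atom a))
    (fun a => y (atom a)) (submxcol (barycenter w y) i) (block_cost w y i).
  split => //.
  - by have := w1 i; rewrite row_sum_block.
  - by move=> a; exact: (Sy (atom a)).
  - by rewrite /barycenter mxcolK.
split; last by move=> i; exact: fhat_le_combination (comb i).
split.
- by move=> l; rewrite -row_sumA.
- by apply/colP => l; rewrite -row_sumG.
- by move=> i; exact: combination_conv_hull (comb i).
Qed.

Hypothesis S_compact : forall i, compact (S i).
Hypothesis f_lsc : forall i,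
  lower_semicontinuous (EFin \o f i : subspace (S i) -> \bar R).

Definition admissible_atoms : set (atoms E) :=
  [set p | admissible (fun j => (p j).1) (fun j => (p j).2)].

Lemma feasible_atoms x : feasible (fun i => conv_hull (S i)) A b G h x ->
  exists p : atoms E, [/\ atoms_in S_ p, admissible_atoms p &
    objective (fun i => fhat (S i) (f i)) x = (cost f_ p)%:E].
Proof.
move=> [xA xG Sx].
(* An optimal decomposition is chosen in each block separately, since the objective is separable. *)
pose P i := cid (envelope_attained (@S_compact i) (@f_lsc i) (Sx i)).
pose p : atoms E := fun j => sval (P (tag j)) (tagged j).
have xE : barycenter (fun j => (p j).1) (fun j => (p j).2) = x.
  rewrite -[RHS]submxcolK; apply/eq_mxcolP => i.
  by have [_ []] := svalP (P i).
exists p; split.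
- by move=> -[i a]; have [+ _ _] := svalP (P i); exact.
- split => [i|l|l].
  + by rewrite row_sum_block; have [_ []] := svalP (P i).
  + by rewrite row_sumA xE.
  + by rewrite row_sumG xE xG.
- rewrite /cost big_tagged -sumEFin; apply: eq_bigr => i _.
  by have [_ _ ->] := svalP (P i).
Qed.

Lemma coef_continuous q j : continuous (@coef q j).
Proof.
have lin m (M : 'M[R]_(m, k (tag j))) l :
    continuous (fun y : 'cV[R]_(k (tag j)) => (M *m y)%R l ord0).
  rewrite (_ : (fun _ => _) = fun y : 'cV[R]_(k (tag j)) =>
    (\sum_c M l c * y c ord0)%R); last by apply/funext => y; rewrite mxE.
  apply: (continuous_big (op := +%R)) => [|c _ y]; first exact: add_continuous.
  exact: (cvgM (cvg_cst _) (@coord_continuous _ _ _ c ord0 y)).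
case: q => [i|[l|l]]; rewrite /coef;
  [exact: cst_continuous|exact: lin|exact: lin].
Qed.

Lemma row_sum_continuous q :
  continuous (fun p : atoms E =>
    row_sum (fun j => (p j).1) (fun j => (p j).2) q).
Proof.
apply: (continuous_big (op := +%R)) => [|j _ p]; first exact: add_continuous.
apply: (cvgM (@weight_continuous _ _ E j p)).
apply: (@continuous_comp _ _ _ (fun p : atoms E => (p j).2) (@coef q j)).
  exact: (@atom_continuous _ _ E j p).
exact: coef_continuous.
Qed.

Lemma closed_admissible_atoms : closed admissible_atoms.
Proof.
pose r q (p : atoms E) := row_sum (fun j => (p j).1) (fun j => (p j).2) q.
rewrite (_ : admissible_atoms =
  \bigcap_i (r (inl i) @^-1` [set 1%R]) `&`
  (\bigcap_l (r (inr (inl l)) @^-1` [set s | (s <= b l ord0)%R]) `&`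
   \bigcap_l (r (inr (inr l)) @^-1` [set h l ord0]))); last first.
  apply/seteqP; split => p.
    move=> [p1 pA pG]; split=> [i _|]; first exact: p1.
    by split => l _; [exact: pA|exact: pG].
  move=> [p1 [pA pG]].
  by split => l; [exact: p1 l I|exact: pA l I|exact: pG l I].
apply: closedI; last apply: closedI; apply: closed_bigI => l _.
- apply: preimage_closed => [p _|]; first exact: row_sum_continuous.
  exact: closed_eq.
- apply: preimage_closed => [p _|]; first exact: row_sum_continuous.
  exact: closed_le.
- apply: preimage_closed => [p _|]; first exact: row_sum_continuous.
  exact: closed_eq.
Qed.

Definition support (w : J -> R) (i : 'I_n) : {set 'I_(k i).+1} :=
  [set a | w (atom a) != 0%R]%SET.

(** The only nonzero weight of the block must be 1. *)
Lemma pure_block w y i : row_sum w y (inl i) = 1%R -> #|support w i| = 1%N ->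
  exists a, block w y i = y (atom a) /\ block_cost w y i = f i (y (atom a)).
Proof.
rewrite row_sum_block => w1 /eqP/cards1P[a supp]; exists a.
have w0 a' : a' != a -> w (atom a') = 0%R.
  move=> a'a; have : a' \notin support w i by rewrite supp inE.
  by rewrite inE negbK => /eqP.
have wa : w (atom a) = 1%R.
  by rewrite -w1 (bigD1 a)//= big1 ?addr0// => a' /w0.
rewrite /block /block_cost; split.
  rewrite (bigD1 a)//= big1 ?addr0 ?wa ?scale1r// => a' /w0 ->.
  by rewrite scale0r.
by rewrite (bigD1 a)//= big1 ?addr0 ?wa ?mul1r// => a' /w0 ->; rewrite mul0r.
Qed.

(** Weights adding up to 1 cannot all vanish, so each block has a nonzero weight and each mixed
    block at least two: [n] plus the number of mixed blocks is at most the size of the support. *)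
Lemma card_mixed_blocks w y c : (forall i, row_sum w y (inl i) = 1%R) ->
    (#|[set j : J | w j != 0%R]%SET| <= n + c)%N ->
  (#|[set i | #|support w i| != 1%N]%SET| <= c)%N.
Proof.
move=> w1.
have -> : #|[set j : J | w j != 0%R]%SET| = (\sum_i #|support w i|)%N.
  rewrite -sum1_card big_mkcond/= big_tagged; apply: eq_bigr => i _.
  rewrite -sum1_card [RHS]big_mkcond/=; apply: eq_bigr => a _.
  by rewrite !inE.
have supp_gt0 i : (0 < #|support w i|)%N.
  rewrite card_gt0; apply/negP => /eqP supp0.
  have : (\sum_(a < (k i).+1) w (atom a) = 0)%R.
    apply: big1 => a _; apply/eqP; apply: contraT => wa.
    by have : a \in support w i; [rewrite inE|rewrite supp0 inE].
  by rewrite -(row_sum_block w y) w1 => /eqP; rewrite oner_eq0.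
move=> sum_le; rewrite -(leq_add2l n); apply: leq_trans sum_le.
rewrite -sum1_card big_mkcond/= -[X in (X + _ <= _)%N]card_ord -sum1_card.
rewrite -big_split/=; apply: leq_sum => i _; rewrite inE.
by case: #|support w i| (supp_gt0 i) => [|[|]].
Qed.

(* Slack variables turn A x <= b into equalities; a slack variable vanishes
   exactly when its constraint is active. *)
Lemma sparse_admissible w y : (forall j, 0 <= w j)%R -> admissible w y ->
  exists w', [/\ forall j, (0 <= w' j)%R, admissible w' y,
    (\sum_j w' j * f_ j (y j) <= \sum_j w j * f_ j (y j))%R &
    (#|[set j : J | w' j != 0%R]%SET| <=
      n + (#|active A b (barycenter w' y)| + m2))%N].
Proof.
move=> w0 [w1 wA wG].
(* The column of a slack variable is a unit vector, and below its cost is 0. *)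
pose L (v : J + 'I_m1) (q : rows) : R := match v with
  | inl j => coef q (y j) | inr l => (q == inr (inl l))%:R end.
pose c (v : J + 'I_m1) := if v is inl j then f_ j (y j) else 0%R.
pose lam (v : J + 'I_m1) := match v with
  | inl j => w j | inr l => b l ord0 - row_sum w y (inr (inl l)) end%R.
have sumL (d : J + 'I_m1 -> R) q : (\sum_v d v * L v q =
    row_sum (d \o inl) y q + \sum_l d (inr l) * (q == inr (inl l))%:R)%R.
  by rewrite big_sumType.
have sumLA (d : J + 'I_m1 -> R) l : (\sum_v d v * L v (inr (inl l)) =
    row_sum (d \o inl) y (inr (inl l)) + d (inr l))%R.
  rewrite sumL (bigD1 l)//= eqxx mulr1 big1 ?addr0// => l' l'l.
  by case: eqP => [[/esym/eqP]|_]; rewrite ?(negbTE l'l)// mulr0.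
have sumLN (d : J + 'I_m1 -> R) q : (forall l, q != inr (inl l)) ->
    (\sum_v d v * L v q = row_sum (d \o inl) y q)%R.
  move=> qN; rewrite sumL big1 ?addr0// => l _.
  by rewrite (negbTE (qN l)) mulr0.
have [||mu [mu0 muL muc muQ]] := @sparse_weights _ _ _ L c lam.
- move=> d d0 dL.
  (* No recession direction: the rows of total weight kill the nonnegative atom part, then the
     inequality rows kill the slacks. *)
  have dJ j : d (inl j) = 0%R.
    have /eqP := dL (inl (tag j)); rewrite sumLN// /row_sum psumr_eq0;
      last first.
      by move=> j' _; rewrite mulr_ge0//= ler0n.
    by move=> /allP/(_ j (mem_index_enum _)); rewrite /= eqxx mulr1 => /eqP.
  case=> [//|l]; have := dL (inr (inl l)); rewrite sumLA.
  by rewrite /row_sum big1 ?add0r// => j _; rewrite /= dJ mul0r.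
- by case=> [//|l]; rewrite /= subr_ge0.
exists (mu \o inl).
have muA l : (mu (inr l) = b l ord0 - row_sum (mu \o inl) y (inr (inl l)))%R.
  have := muL (inr (inl l)); rewrite !sumLA/= [in RHS]addrC subrK => <-.
  by rewrite addrC addKr.
split.
- by move=> j; exact: mu0.
- split => [i|l|l].
  + by rewrite -(w1 i); have := muL (inl i); rewrite !sumLN.
  + by rewrite -subr_ge0 -muA.
  + by rewrite -(wG l); have := muL (inr (inr l)); rewrite !sumLN.
- have := muc; rewrite !big_sumType/=.
  rewrite [X in (_ + X <= _)%R]big1 => [|? _]; last by rewrite mulr0.
  by rewrite [X in (_ <= _ + X)%R]big1 => [|? _]; rewrite ?mulr0// !addr0.
(* The support has at most [n + m1 + m2] elements, of which [m1] minus the number of active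
   constraints are slacks. *)
- have active_slack : #|active A b (barycenter (mu \o inl) y)| =
      #|[set l | mu (inr l) == 0%R]%SET|.
    apply: eq_card => l; rewrite !inE muA row_sumA subr_eq0 mxE.
    by rewrite [X in (_ + X == _)%R]mxE subr_eq0 eq_sym.
  have slack : (#|[set l | mu (inr l) == 0%R]%SET| +
      #|[set l | mu (inr l) != 0%R]%SET| = m1)%N.
    rewrite -[RHS]card_ord -(cardsC [set l | mu (inr l) == 0%R]%SET).
    by congr (_ + _)%N; apply: eq_card => l; rewrite !inE.
  have := muQ; rewrite !card_sum !card_ord active_slack.
  have -> : (#|[set v | mu v != 0%R]%SET| =
      #|[set j | (mu \o inl) j != 0%R]%SET| +
      #|[set l | mu (inr l) != 0%R]%SET|)%N.
    rewrite -!sum1_card [LHS]big_mkcond big_sumType/=.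
    rewrite [X in _ = (X + _)%N]big_mkcond [X in _ = (_ + X)%N]big_mkcond/=.
    by congr (_ + _)%N; apply: eq_bigr => ? _; rewrite !inE.
  move: slack; move: #|[set l | mu (inr l) == 0%R]%SET|
    #|[set l | mu (inr l) != 0%R]%SET| #|[set j | (mu \o inl) j != 0%R]%SET|.
  by clear=> s0 s1 s2; lia.
Qed.

End separable.

(** * Active constraints and the final estimate *)

Lemma active_le_max (R : realType) (n : nat) (k : 'I_n -> nat) (m1 : nat)
    (A : 'M[R]_(m1, (\sum_(i < n) k i)%N)) (b : 'cV[R]_m1) x :
  (#|active A b x| <= max_active A b)%N.
Proof.
have lt : (#|active A b x| < m1.+1)%N.
  by rewrite ltnS -[leqRHS]card_ord max_card.
apply: (bigop.leq_bigmax_cond (Ordinal lt)).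
by apply/asboolP; exists x.
Qed.

Unset Implicit Arguments.

Theorem theorem1 (R : realType) (n : nat) (k : 'I_n -> nat)
  (S : forall i : 'I_n, set 'cV[R]_(k i))
  (f : forall i : 'I_n, 'cV[R]_(k i) -> R)
  (m1 m2 : nat)
  (A : 'M[R]_(m1, (\sum_(i < n) k i)%N)) (b : 'cV[R]_m1)
  (G : 'M[R]_(m2, (\sum_(i < n) k i)%N)) (h : 'cV[R]_m2)
  (S_compact : forall i, compact (S i))
  (f_lsc : forall i,
    lower_semicontinuous (EFin \o f i : subspace (S i) -> \bar R))
  (A_blocks : involves_two_blocks A)
  (G_blocks : involves_two_blocks G)
  (rho_sorted : forall i j : 'I_n, (i <= j)%N ->
    nonconvexity (S j) (f j) <= nonconvexity (S i) (f i))
  (P_feasible : exists x, feasible S A b G h x) :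
  let convS := fun i => conv_hull (S i) in
  let fS := fun i => extend (S i) (EFin \o f i) in
  let fhatS := fun i => fhat (S i) (f i) in
  let phat := optimal_value convS fhatS A b G h in
  let mt := (max_active A b + m2)%N in
  exists x : 'cV[R]_(\sum_(i < n) k i)%N,
    [/\ solution convS fhatS A b G h x,
        phat = objective fhatS x,
        objective fhatS x <= objective fS x &
        objective fS x <=
          phat + \sum_(i < n | (i < minn mt n)%N) nonconvexity (S i) (f i)].
Proof.
move=> convS fS fhatS phat mt.
have fhatSW i z : fhatS i z <= fS i z by exact: fhat_majorized.
have [x0 [x0A x0G Sx0]] := P_feasible.
have feas0 : feasible convS A b G h x0.
  by split => // i B [_]; apply; exact: Sx0.
have [p0 [Sp0 adm0 _]] := feasible_atoms S_compact f_lsc feas0.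
have [|p [Sp adm_p] p_min] := cost_attains_min (fun j => @S_compact (tag j))
  (fun j => @f_lsc (tag j)) (@closed_admissible_atoms _ _ _ _ _ A b G h).
  by exists p0.
have phat_ge : (cost (fun j => f (tag j)) p)%:E <= phat.
  apply: le_ereal_inf_tmp => _ [z zfeas <-].
  have [q [Sq adm_q ->]] := feasible_atoms S_compact f_lsc zfeas.
  by rewrite lee_fin p_min.
pose y j := (p j).2.
have Sy j : S (tag j) (y j) by have [] := Sp j.
have w0 j : (0 <= (p j).1)%R by have [/andP[]] := Sp j.
(* The optimal atoms stay fixed; only their weights are made sparse. *)
have [w [{}w0 adm_w w_cost w_supp]] := sparse_admissible f w0 adm_p.
have [xfeas fhat_le] := admissible_feasible f w0 Sy adm_w.
set x := barycenter w y in xfeas fhat_le w_supp.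
have xE i : submxcol x i = block w y i by rewrite /x /barycenter mxcolK.
have [r fhat_r] : exists r : 'I_n -> R,
    forall i, fhatS i (submxcol x i) = (r i)%:E.
  have Cx i : conv_hull (S i) (submxcol x i) by have [_ _] := xfeas.
  pose P i := cid (envelope_attained (@S_compact i) (@f_lsc i) (Cx i)).
  by eexists => i; have [_ _ E] := svalP (P i); exact: E.
have r_le i : (r i <= block_cost f w y i)%R.
  by rewrite -lee_fin -fhat_r; exact: fhat_le.
have objE : objective fhatS x = (\sum_i r i)%:E.
  by rewrite /objective -sumEFin; apply: eq_bigr => i _.
have costE : (\sum_j w j * f (tag j) (y j) = \sum_i block_cost f w y i)%R.
  by rewrite big_tagged.
have phat_le : phat <= objective fhatS x by apply: ereal_inf_lbound; exists x.
(* The block costs sum to at most the cost of [p], hence at most [phat], the objective at [x] and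
   the sum of the [r i]; with [r_le] the chain closes up into equalities. *)
have sum_eq : (\sum_i block_cost f w y i <= \sum_i r i)%R.
  rewrite -costE; apply: (le_trans w_cost).
  by rewrite -lee_fin -objE; exact: le_trans phat_ge phat_le.
have phatE : phat = objective fhatS x.
  apply/eqP; rewrite eq_le phat_le/= objE; apply: le_trans phat_ge.
  by rewrite lee_fin; apply: le_trans w_cost; rewrite costE; exact: ler_sum.
(* Termwise inequalities with equal sums are termwise equalities. *)
have rE i : r i = block_cost f w y i.
  apply/eqP; rewrite eq_le r_le/= -subr_le0.
  have -> : (block_cost f w y i - r i =
      \sum_j (block_cost f w y j - r j) -
      \sum_(j | j != i) (block_cost f w y j - r j))%R.
    by rewrite [X in (_ = X - _)%R](bigD1 i)//= addrK.
  rewrite subr_le0 sumrB; apply: (@le_trans _ _ 0%R); first by rewrite subr_le0.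
  by apply: sumr_ge0 => j _; rewrite subr_ge0.
exists x; split => //.
  by apply: lee_sum.
have [w1 _ _] := adm_w.
(* The mixed blocks, the only ones where [f] may exceed its envelope at [x]. *)
pose B := [set i | #|support w i| != 1%N]%SET.
have Bmt : (#|B| <= minn mt n)%N.
  rewrite leq_min -[X in _ && (_ <= X)%N]card_ord max_card andbT.
  apply: card_mixed_blocks w1 _; apply: leq_trans w_supp _.
  by rewrite leq_add2l leq_add2r active_le_max.
have rho0 i : 0 <= nonconvexity (S i) (f i) by exact: nonconvexity_ge0.
rewrite phatE; apply: (@le_trans _ _ (objective fhatS x +
    \sum_(i in B) nonconvexity (S i) (f i))); last first.
  by rewrite leeD2l//; exact: sum_le_initial.
rewrite big_mkcond -big_split/=; apply: lee_sum => i _.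
case: ifPn => [_|].
  by apply: extend_le_fhatD; rewrite -/(fhatS i) fhat_r.
(* In a pure block [x] is an atom of [S i], so the block cost, equal to the envelope by [rE], is the
   value of [f i] there. *)
rewrite inE negbK adde0 fhat_r rE => /eqP/(pure_block f (w1 i))[a [ya ->]].
rewrite xE ya /fS /extend patchT// inE.
exact: (Sy (Tagged _ a)).
Qed.
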